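(* (The scheme of rules $\{\mathbf{R_k}\mid k\in\mathbb N\}$ is in general not complete.) There exist $x\in\{\mathrm{ir},\mathrm{iR}\}$, agents $(M^{(1)},R^{(1)}),\dots,(M^{(n)},R^{(n)})$ with pairwise asynchronous modules, a coalition $C\subseteq\{1,\dots,n\}$, and for each $i\in C$ a formula $\psi_i$ of LTL without the next operator local to agent $i$, such that $$(M^{(1)}|\dots|M^{(n)},\,R^{(1)},\dots,R^{(n)})\models_x \langle\langle C\rangle\rangle\bigwedge_{i\in C}\psi_i,$$ but there are no $k\ge 1$ and assumptions $(A_i)_{i\in C}$ for which both (1) $(M^{(i)}|A_i,\,R^{(i)})\models_x \langle\langle i\rangle\rangle\psi_i$ for every $i\in C$, and (2) $\mathit{Comp}^{(i)}_k\models A_i$ (that is, $\mathit{Comp}^{(i)}_k$ guarantees $A_i$) for every $i\in C$ hold.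
   Context: **Modules.** $D$ is a fixed set of values; $D^X$ is the set of valuations $X\to D$. A module is $M=(X,I,Q,T,\lambda,q_0)$ with $X$ (state variables) and $I$ (input variables) finite disjoint sets, $Q$ a finite set of states, $q_0\in Q$ initial, $\lambda:Q\to D^X$, and $T\subseteq Q\times D^I\times Q$ such that (a) for each $(q,\alpha)\in Q\times D^I$ there is $q'$ with $(q,\alpha,q')\in T$, and (b) $(q,\alpha,q')\in T$ and $q\ne q'$ imply $(q,\alpha,q)\notin T$. Modules are asynchronous if their sets of state variables are disjoint. A repertoire for $M$ is a map $R:Q\to\mathcal P(\mathcal P(T))$ such that each $R(q)$ is nonempty and consists of nonempty sets of transitions starting in $q$. An agent is a pair (module, repertoire). **Composition.** Valuations $\rho_1\in D^Y,\rho_2\in D^Z$ are compatible, $\rho_1\sim\rho_2$, if they agree on $Y\cap Z$; then $\rho_1\cup\rho_2\in D^{Y\cup Z}$ is their union. For asynchronous $M^{(1)},M^{(2)}$, the composition $M^{(1)}|M^{(2)}$ has state variables $X=X^{(1)}\uplus X^{(2)}$, inputs $I=(I^{(1)}\cup I^{(2)})\setminus X$, states $Q^{(1)}\times Q^{(2)}$, initial state $(q_0^{(1)},q_0^{(2)})$, labelling $\lambda(q^{(1)},q^{(2)})=\lambda^{(1)}(q^{(1)})\cup\lambda^{(2)}(q^{(2)})$, and transitions as follows. Whenever $(q^{(1)},\alpha^{(1)},q'^{(1)})\in T^{(1)}$, $(q^{(2)},\alpha^{(2)},q'^{(2)})\in T^{(2)}$, $\alpha^{(1)}\sim\alpha^{(2)}$,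 $\lambda^{(1)}(q^{(1)})\sim\alpha^{(2)}$ and $\lambda^{(2)}(q^{(2)})\sim\alpha^{(1)}$, there are transitions from $(q^{(1)},q^{(2)})$, labelled by $\alpha^{(1)}\cup\alpha^{(2)}$ restricted to $I$, to each of $(q'^{(1)},q^{(2)})$, $(q^{(1)},q'^{(2)})$, $(q'^{(1)},q'^{(2)})$; finally every self-loop $(q,\alpha,q)$ for which some $(q,\alpha,q')$ with $q'\neq q$ is present is removed. This extends to any finite number of pairwise asynchronous modules (order is irrelevant); the empty composition is the one-state module with no variables. **Traces.** A trace of $M$ is an infinite sequence $\sigma=q_0\alpha_0q_1\alpha_1\dots$ starting in the initial state with $(q_j,\alpha_j,q_{j+1})\in T$ for all $j$. The word derived with $\sigma$ is $\lambda(q_0)\lambda(q_1)\dots$; the word admitted with $\sigma$ is $\alpha_0\alpha_1\dots$. **Assumptions.** An assumption $A=(M,F)$ is a module with a set $F\subseteq Q$ of accepting states. A word $w=v_0v_1\dots\in(D^X)^\omega$ is accepted by $A$ with computation $\alpha_0\alpha_1\dots$ if there is a trace $\sigma=q_0\alpha_0q_1\alpha_1\dots$ of $M$ with $\lambda(q_j)=v_j$ for all $j$ that visits $F$ infinitely often; $w$ is accepted by $A$ if this holds for some computation. For a module $M$ and an assumption $A'=(M',F')$ with $M,M'$ asynchronous, $M|A'=(M|M',F)$ with $F=\{(q,q')\mid q'\in F'\}$. **Guarantee.** Let $M=M^{(a_1)}|\dots|M^{(a_m)}$ with state variables $X$, and let $A$ be an assumption with state variables $X_A\subseteq X$ and inputs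 $I_A\subseteq\bigcup_l I^{(a_l)}$. Then $M\models A$ (''$M$ guarantees $A$'') if for every trace $\sigma$ of $M$, with derived word $w=w_0w_1\dots$ and admitted word $u=u_0u_1\dots$, there are indices $0=c_0<c_1<c_2<\dots$ and a word $v=v_0v_1\dots\in (D^{X_A})^\omega$ with $v_i=w_l|_{X_A}$ for all $i$ and all $c_i\le l<c_{i+1}$ (a curtailment of $w$ to $X_A$) such that $v$ is accepted by $A$ with the computation $a_0a_1\dots$, where $a_i\in D^{I_A}$ is the restriction to $I_A$ of $u_{c_{i+1}-1}\cup w_{c_{i+1}-1}$ (variables of $I_A$ that are state variables of $M$ take their value from $w$, the others from $u$). The relation $M\models A$ is only asserted when $X_A\subseteq X$ and $I_A\subseteq\bigcup_l I^{(a_l)}$ hold. **Strategies.** In a system whose global states are tuples of local states of component modules, an ir-strategy (memoryless) of agent $i$ is $s_i:Q^{(i)}\to\mathcal P(T^{(i)})$ with $s_i(q)\in R^{(i)}(q)$. An iR-strategy (perfect recall) is $s_i:(Q^{(i)})^+\to\mathcal P(T^{(i)})$ with $s_i(q_1,\dots,q_m)\in R^{(i)}(q_m)$ which is stuttering-invariant: its value is unchanged when consecutive repetitions of a state are merged. A trace $\sigma=q_0\alpha_0q_1\alpha_1\dots$ of the composed module implements $s_i$ if for all $j$ with $q_j^{(i)}\ne q_{j+1}^{(i)}$ we have $(q_j^{(i)},\beta_j,q_{j+1}^{(i)})\in s_i(q_j^{(i)})$ (for iR: $\in s_i(q_0^{(i)},\dots,q_j^{(i)})$), where $\beta_j\in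 D^{I^{(i)}}$ takes the value $\lambda(q_j)(y)$ on input variables $y$ that are state variables of the composed module, and $\alpha_j(y)$ otherwise. A joint strategy $s_C$ is a family of strategies $s_i$, $i\in C$; a trace implements $s_C$ if it implements each $s_i$; a word implements $s_C$ if it is derived with some trace implementing $s_C$. **Semantics.** LTL without next: $\gamma::=p\mid\neg\gamma\mid\gamma\wedge\gamma\mid\gamma\,\mathrm U\,\gamma$, where an atom is a valuation $p:Y\to D$, true on a word $w$ iff $w[0]|_Y=p$; $\mathrm U$ is strong until, interpreted on infinite words as usual. For a system $(M,R^{(1)},\dots)$ we write $\models_x\langle\langle C\rangle\rangle\gamma$ if there is a joint $x$-strategy $s_C$ such that every word (from the initial state) implementing $s_C$ satisfies $\gamma$. For a system based on an assumption $A$, $\models_x\langle\langle C\rangle\rangle\gamma$ if there is a joint $x$-strategy $s_C$ such that every word that implements $s_C$ and is accepted by $A$ satisfies $\gamma$; the component coming from the assumption has no strategy. Such statements presuppose that all variables of $\gamma$ are state variables of the composed module. A formula is local to agent $i$ if its atoms are valuations of variables of $M^{(i)}$ (state or input variables). **Neighbourhoods.** $N^{(i)}_1$ is the set of indices $j$ with $I^{(j)}\cap X^{(i)}\neq\varnothing$ or $I^{(i)}\cap X^{(j)}\ne\varnothing$; for $k>1$, $N^{(i)}_k=(N^{(i)}_{k-1}\cup\bigcup_{j\in N^{(i)}_{k-1}}N^{(j)}_1)\setminus\{i\}$. $\mathit{Comp}^{(i)}_k$ is the composition of the modules $M^{(j)}$, $j\in N^{(i)}_k$. *)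

(* Defs.v *)
From mathcomp Require Import all_boot finmap.
From mathcomp Require Import boolp classical_sets.

Set Implicit Arguments.
Unset Strict Implicit.
Unset Printing Implicit Defensive.

Definition var := nat.

(* A valuation in D^X is a finite map with domain X.  For compatible r1 and r2
   the union of r1 and r2 is [(r1 + r2)%fset]; the restriction of r to Y is
   [r.[& Y]%fmap], whose domain is the intersection of Y and [domf r]. *)
Notation valuation D := {fmap var -> D}.

Definition compat (D : Type) (r1 r2 : valuation D) : Prop :=
  forall y, y \in domf r1 -> y \in domf r2 -> r1.[? y]%fmap = r2.[? y]%fmap.

Record module (D : Type) := MkModule {
  state :> finType;
  svars : {fset var};
  ivars : {fset var};
  lab : state -> valuation D;
  trans : set (state * valuation D * state);
  init : state;
  svars_ivars : [disjoint svars & ivars]%fset;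
  dom_lab : forall q, domf (lab q) = svars;
  dom_trans : forall q a q', trans (q, a, q') -> domf a = ivars;
  trans_total : forall q a, domf a = ivars -> exists q', trans (q, a, q');
  trans_loop : forall q a q', trans (q, a, q') -> q <> q' -> ~ trans (q, a, q)
}.

Arguments lab {D} M q : rename.
Arguments trans {D} M t : rename.
Arguments init {D} M : rename.

Definition transition (D : Type) (M : module D) : Type :=
  (M * valuation D * M)%type.

Definition asynchronous (D : Type) (M1 M2 : module D) : Prop :=
  [disjoint svars M1 & svars M2]%fset.

Section Composition.
Context (D : Type) (M1 M2 : module D).

Definition comp_svars : {fset var} := (svars M1 `|` svars M2)%fset.
Definition comp_ivars : {fset var} :=
  ((ivars M1 `|` ivars M2) `\` comp_svars)%fset.
Definition comp_lab (q : M1 * M2) : valuation D :=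
  (lab M1 q.1 + lab M2 q.2)%fset.

(* The transitions before the removal of self-loops. *)
Definition comp_step (t : (M1 * M2) * valuation D * (M1 * M2)) : Prop :=
  let: (q, a, r) := t in
  exists (a1 a2 : valuation D) (r1 : M1) (r2 : M2),
    [/\ trans M1 (q.1, a1, r1), trans M2 (q.2, a2, r2) &
        a = (a1 + a2)%fset.[& comp_ivars]%fmap] /\
    [/\ compat a1 a2, compat (lab M1 q.1) a2 & compat (lab M2 q.2) a1] /\
    [\/ r = (r1, q.2), r = (q.1, r2) | r = (r1, r2)].

Definition comp_trans (t : (M1 * M2) * valuation D * (M1 * M2)) : Prop :=
  let: (q, a, r) := t in
  comp_step (q, a, r) /\
  ~ (r = q /\ exists r', comp_step (q, a, r') /\ r' <> q).

Fact comp_svars_ivars : [disjoint comp_svars & comp_ivars]%fset.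
Proof.
by apply/fdisjointP => y ys; rewrite /comp_ivars in_fsetD ys.
Qed.

Fact comp_dom_lab q : domf (comp_lab q) = comp_svars.
Proof. by rewrite /comp_lab domf_cat !dom_lab. Qed.

Fact comp_dom_trans q a r : comp_trans (q, a, r) -> domf a = comp_ivars.
Proof.
case=> -[a1 [a2 [r1 [r2 [[/dom_trans d1 /dom_trans d2 ->] _]]]]] _.
apply/fsetP => y; rewrite domf_restrict domf_cat d1 d2 in_fsetI.
rewrite [in LHS]in_fsetD [in RHS]in_fsetD.
by case: (_ \in (_ `|` _)%fset); rewrite ?andbF ?andbT.
Qed.

Fact comp_trans_total q a :
  domf a = comp_ivars -> exists r, comp_trans (q, a, r).
Proof.
move=> da; pose e := (a + comp_lab q)%fset.
have de : domf e = (comp_ivars `|` comp_svars)%fset.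
  by rewrite domf_cat da comp_dom_lab.
have dI (J : {fset var}) : (J `<=` ivars M1 `|` ivars M2)%fset ->
    domf e.[& J]%fmap = J.
  move=> /fsubsetP sJ; apply/fsetP => y; rewrite domf_restrict de in_fsetI in_fsetU in_fsetD;
  case yJ: (y \in J) => //=.
  by rewrite sJ // andbT orNb.
have d1 := dI _ (fsubsetUl (ivars M1) (ivars M2)).
have d2 := dI _ (fsubsetUr (ivars M1) (ivars M2)).
have [r1 t1] := trans_total q.1 d1; have [r2 t2] := trans_total q.2 d2.
have notin (M : module D) y : y \in svars M -> y \notin ivars M.
  by apply: (fdisjointP (svars_ivars M)).
have ml (M : module D) r y : (y \in domf (lab M r)) = (y \in svars M).
  by rewrite dom_lab.
have mc y : (y \in domf (comp_lab q)) = (y \in comp_svars).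
  by rewrite comp_dom_lab.
have m2 y : (y \in domf e.[& ivars M2]%fmap) = (y \in ivars M2) by rewrite d2.
have eqa : a = (e.[& ivars M1] + e.[& ivars M2])%fset.[& comp_ivars]%fmap.
  apply/fmapP => y; rewrite fnd_restrict fnd_cat m2 !fnd_restrict fnd_cat mc.
  case yI: (y \in comp_ivars); last first.
    by apply: not_fnd; move: yI; rewrite -da => /negbT.
  move: (yI); rewrite in_fsetD => /andP[/negbTE -> ]; rewrite in_fsetU.
  by case: (y \in ivars M1); case: (y \in ivars M2).
have step r : [\/ r = (r1, q.2), r = (q.1, r2) | r = (r1, r2)] ->
    comp_step (q, a, r).
  move=> hr; do 4 eexists; split.
    by split; [exact: t1|exact: t2|exact: eqa].
  split=> //; split=> y y1 y2; move: y1 y2; rewrite [in X in X -> _](d1, dom_lab) => y1;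
    rewrite [in X in X -> _](d1, d2) => y2.
  - by rewrite !fnd_restrict y1 y2.
  - rewrite fnd_restrict y2 fnd_cat mc in_fsetU y1 /= fnd_cat ml.
    by case: ifP => // ys; have := notin M2 y ys; rewrite y2.
  - by rewrite fnd_restrict y2 fnd_cat mc in_fsetU y1 orbT fnd_cat ml y1.
have [[r [sr nr]]|nr] := pselect (exists r, comp_step (q, a, r) /\ r <> q).
  by exists r; split=> // -[].
by exists (r1, r2); split; [apply: step; exact: Or33|move=> []].
Qed.

Fact comp_trans_loop q a r :
  comp_trans (q, a, r) -> q <> r -> ~ comp_trans (q, a, q).
Proof.
by move=> [tr _] qr [_]; apply; split=> //; exists r; split=> // /esym.
Qed.

Definition compose : module D :=
  @MkModule D (M1 * M2)%type comp_svars comp_ivars comp_lab comp_trans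
    (init M1, init M2) comp_svars_ivars comp_dom_lab comp_dom_trans
    comp_trans_total comp_trans_loop.

End Composition.

Section EmptyModule.
Context (D : Type).

Definition empty_trans (t : unit * valuation D * unit) : Prop :=
  t.1.2 = [fmap]%fmap.

Fact empty_dom_trans q a q' : empty_trans (q, a, q') -> domf a = fset0.
Proof. by rewrite /empty_trans /= => ->; rewrite domf0. Qed.

Fact empty_trans_total q a : domf a = fset0 -> exists q', empty_trans (q, a, q').
Proof.
move=> da; exists tt; rewrite /empty_trans /=.
apply/fmapP => y; rewrite fnd_fmap0; apply: not_fnd.
by have := in_fset0 y; rewrite -da => /negbT.
Qed.

Fact empty_trans_loop q a q' :
  empty_trans (q, a, q') -> q <> q' -> ~ empty_trans (q, a, q).
Proof. by case: q; case: q'. Qed.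

Definition empty_module : module D :=
  @MkModule D unit fset0 fset0 (fun=> [fmap]%fmap) empty_trans tt
    (fdisjoint0X _) (fun=> domf0 _ _) empty_dom_trans empty_trans_total
    empty_trans_loop.

End EmptyModule.

Section System.
Context (D : Type) (I : eqType) (M : I -> module D).

Fixpoint comps (s : seq I) : module D :=
  if s is i :: s' then compose (M i) (comps s') else empty_module D.

(* The local state of component i in a global state of [comps s]; it is the
   arbitrary [init (M i)] when i does not occur in s. *)
Fixpoint local (s : seq I) (i : I) : comps s -> M i :=
  match s return comps s -> M i with
  | [::] => fun=> init (M i)
  | j :: s' => fun q =>
      match @eqP _ j i with
      | ReflectT ji => ecast k (M k) ji q.1
      | ReflectF _ => local i q.2
      end
  end.

End System.

Section Traces.
Context (D : Type).
Implicit Types (M : module D).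

Definition is_trace M (q : nat -> M) (a : nat -> valuation D) : Prop :=
  q 0 = init M /\ forall j, trans M (q j, a j, q j.+1).

Definition derived M (q : nat -> M) : nat -> valuation D :=
  fun j => lab M (q j).

Record assumption := Assumption {
  amod :> module D;
  accepting : {set amod}
}.

Definition accepted_with (A : assumption) (v a : nat -> valuation D) : Prop :=
  exists q : nat -> A,
    [/\ is_trace q a, derived q = v &
        forall j, exists l, (j <= l) && (q l \in accepting A)].

Definition accepted (A : assumption) (v : nat -> valuation D) : Prop :=
  exists a, accepted_with A v a.

Definition comp_assumption M (A : assumption) : assumption :=
  @Assumption (compose M A) [set q : M * A | q.2 \in accepting A]%SET.

(* The composition of the modules [M i], i in s, guarantees A. *)
Definition guarantees (I : eqType) (M : I -> module D) (s : seq I)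
    (A : assumption) : Prop :=
  [/\ (svars A `<=` svars (comps M s))%fset,
      (ivars A `<=` \bigcup_(i <- s) ivars (M i))%fset &
      forall (q : nat -> comps M s) (u : nat -> valuation D), is_trace q u ->
        let w := derived q in
        exists (c : nat -> nat) (v : nat -> valuation D),
          [/\ c 0 = 0, forall i, c i < c i.+1,
              forall i l, c i <= l < c i.+1 -> v i = (w l).[& svars A]%fmap &
              accepted_with A v
                (fun i => (u (c i.+1).-1 + w (c i.+1).-1)%fset.[& ivars A]%fmap)]].

End Traces.

Record agent (D : Type) := Agent {
  agmod :> module D;
  repertoire : agmod -> set (set (transition agmod));
  repertoire_neq0 : forall q, (repertoire q !=set0)%classic;
  repertoire_trans : forall q S, repertoire q S ->
    (S !=set0)%classic /\ forall t, S t -> trans agmod t /\ t.1.1 = q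
}.

Inductive strategy_type := ir | iR.

Section Strategies.
Context (D : Type).

(* The value of an iR-strategy on the empty sequence is irrelevant. *)
Definition strategy (x : strategy_type) (M : module D) : Type :=
  match x with
  | ir => M -> set (transition M)
  | iR => seq M -> set (transition M)
  end.

Definition is_strategy (x : strategy_type) (G : agent D) : strategy x G -> Prop :=
  match x return strategy x G -> Prop with
  | ir => fun s => forall q, repertoire q (s q)
  | iR => fun s =>
      (forall h q, repertoire q (s (rcons h q))) /\
      (forall h q h', s (h ++ [:: q, q & h']) = s (h ++ q :: h'))
  end.

(* The transitions prescribed at time j along the local state sequence q. *)
Definition prescribed (x : strategy_type) (M : module D) :
    strategy x M -> (nat -> M) -> nat -> set (transition M) :=
  match x return strategy x M -> (nat -> M) -> nat -> set (transition M) with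
  | ir => fun s q j => s (q j)
  | iR => fun s q j => s (mkseq q j.+1)
  end.

(* Here [loc] maps states of the composed module M to those of its component
   N.  The finite map [(a j + lab M (q j))%fset] takes the values of [lab M (q j)]
   on the state variables of M. *)
Definition trace_implements (x : strategy_type) (M N : module D) (loc : M -> N)
    (s : strategy x N) (q : nat -> M) (a : nat -> valuation D) : Prop :=
  forall j, loc (q j) <> loc (q j.+1) ->
    prescribed s (loc \o q) j
      (loc (q j), (a j + lab M (q j))%fset.[& ivars N]%fmap, loc (q j.+1)).

End Strategies.

Section LTL.
Context (D : Type).

Inductive formula :=
  | Atom of valuation D
  | Neg of formula
  | And of formula & formula
  | Until of formula & formula.

Fixpoint fvars (f : formula) : {fset var} :=
  match f with
  | Atom p => domf p
  | Neg f => fvars f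
  | And f g | Until f g => (fvars f `|` fvars g)%fset
  end.

Fixpoint sat (w : nat -> valuation D) (f : formula) : Prop :=
  match f with
  | Atom p => (w 0).[& domf p]%fmap = p
  | Neg f => ~ sat w f
  | And f g => sat w f /\ sat w g
  | Until f g => exists j, sat (fun m => w (j + m)) g /\
      forall l, l < j -> sat (fun m => w (l + m)) f
  end.

(* The conjunction of the empty family is the atom of the empty valuation,
   which holds on every word. *)
Definition big_and (fs : seq formula) : formula :=
  foldr And (Atom [fmap]%fmap) fs.

Definition local_formula (M : module D) (f : formula) : Prop :=
  (fvars f `<=` svars M `|` ivars M)%fset.

End LTL.

Section Semantics.
Context (D : Type) (x : strategy_type).

(* (M^(1)|...|M^(n), R^(1), ..., R^(n)) |=_x <<C>> f *)
Definition sys_sat (n : nat) (G : 'I_n -> agent D) (C : {set 'I_n})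
    (f : formula D) : Prop :=
  (fvars f `<=` svars (comps G (enum 'I_n)))%fset /\
  exists s : forall i, strategy x (G i),
    (forall i, i \in C -> is_strategy (s i)) /\
    forall w : nat -> valuation D,
      (exists (q : nat -> comps G (enum 'I_n)) (a : nat -> valuation D),
         [/\ is_trace q a,
             forall i, i \in C ->
               trace_implements (@local _ _ G (enum 'I_n) i) (s i) q a &
             derived q = w]) ->
      sat w f.

(* (M|A, R) |=_x <<i>> f, for the agent G = (M, R) with index i *)
Definition assume_sat (G : agent D) (A : assumption D) (f : formula D) : Prop :=
  [/\ asynchronous G A, (fvars f `<=` svars (compose G A))%fset &
  exists s : strategy x G, is_strategy s /\
    forall w : nat -> valuation D,
      (exists (q : nat -> compose G A) (a : nat -> valuation D),
         [/\ is_trace q a, trace_implements (fun r : compose G A => r.1) s q a &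
             derived q = w]) ->
      accepted (comp_assumption G A) w -> sat w f].

End Semantics.

Section Neighbourhoods.
Context (D : Type) (n : nat) (M : 'I_n -> module D).

Definition nbhd1 (i : 'I_n) : {set 'I_n} :=
  [set j | ((ivars (M j) `&` svars (M i)) != fset0)%fset ||
           ((ivars (M i) `&` svars (M j)) != fset0)%fset]%SET.

(* Only meaningful for k >= 1. *)
Definition nbhd (k : nat) (i : 'I_n) : {set 'I_n} :=
  iter k.-1 (fun N => (N :|: \bigcup_(j in N) nbhd1 j) :\ i)%SET (nbhd1 i).

End Neighbourhoods.

(* Main.v *)
Require Import Defs.
From mathcomp Require Import all_boot finmap.
From mathcomp Require Import boolp classical_sets.

Set Implicit Arguments.
Unset Strict Implicit.
Unset Printing Implicit Defensive.

(* The observer has one state and reads variable 0, which is owned by the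
   chooser.  The chooser moves once, from [None] to an absorbing state: to
   [Some false], keeping the value d0, or to [Some true], with value d1.  Its
   strategy "never enter [Some true]" makes "always variable 0 <> d1" hold.  But
   an assumption guaranteed by the unrestricted chooser module has to accept the
   word d0 d1 d1 ..., which no strategy of the observer can exclude. *)

Lemma valuation0 (D : Type) (a : valuation D) :
  domf a = fset0 -> a = [fmap]%fmap.
Proof.
move=> da; apply/fmapP => y; rewrite fnd_fmap0 not_fnd //.
by have := in_fset0 y; rewrite -da => /negbT.
Qed.

Lemma domf_fmap1 (D : Type) (y : var) (d : D) :
  domf [fmap].[y <- d]%fmap = [fset y]%fset.
Proof. by rewrite dom_setf domf0 fsetU0. Qed.

(** * Agents free to commit to any nonempty set of moves *)

Section FullRepertoire.
Context (D : Type) (d : D) (M : module D).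

Definition full_repertoire (q : M) (S : set (transition M)) : Prop :=
  (S !=set0)%classic /\ forall t, S t -> trans M t /\ t.1.1 = q.

Fact full_repertoire_neq0 q : (full_repertoire q !=set0)%classic.
Proof.
(* The constant valuation [d] supplies an input to which totality applies. *)
have [|r tr] := @trans_total _ M q [fmap y : ivars M => d]%fmap; first by [].
exists (fun t => t = (q, [fmap y : ivars M => d]%fmap, r)).
by split=> [|t ->]; first by eexists.
Qed.

Definition full_agent : agent D :=
  Agent full_repertoire_neq0 (fun q S => id).

End FullRepertoire.

(** * The reading agent and traces beside it *)

Section Observer.
Context (D : Type).

Definition observer_trans (t : unit * valuation D * unit) : Prop :=
  domf t.1.2 = [fset 0]%fset.

Fact observer_dom_trans q a q' :
  observer_trans (q, a, q') -> domf a = [fset 0]%fset.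
Proof. by []. Qed.

Fact observer_trans_total q a :
  domf a = [fset 0]%fset -> exists q', observer_trans (q, a, q').
Proof. by exists tt. Qed.

Fact observer_trans_loop q a q' :
  observer_trans (q, a, q') -> q <> q' -> ~ observer_trans (q, a, q).
Proof. by case: q; case: q'. Qed.

Definition observer : module D :=
  @MkModule D unit fset0 [fset 0]%fset (fun=> [fmap]%fmap) observer_trans tt
    (fdisjoint0X _) (fun=> domf0 _ _) observer_dom_trans observer_trans_total
    observer_trans_loop.

(** The observer loops under every input, so it can read the current label of [M] without hindering
    any move of [M]. The delicate point is the removal of self-loops: a proper move of the pair
    would be a proper move of [M], and then [trans_loop] forbids [M] to stay. *)
Lemma observer_trace (M : module D) (q : nat -> M) (a : nat -> valuation D) :
  svars M = [fset 0]%fset -> ivars M = fset0 -> is_trace q a ->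
  @is_trace D (compose observer M) (fun j => (tt, q j)) a.
Proof.
move=> sM iM [q0 tq]; split=> [|j]; first by rewrite q0.
have a0 b r r' : trans M (r, b, r') -> b = [fmap]%fmap.
  by move=> /dom_trans; rewrite iM => /valuation0.
split.
  exists (lab M (q j)), (a j), tt, (q j.+1).
  split; [split=> //= | split; [split=> //= | exact: Or33]].
  - by rewrite /observer_trans /= dom_lab.
  (* Variable 0 is a state variable of the composition, so no input is left there. *)
  - apply/esym; rewrite (a0 _ _ _ (tq j)); apply: valuation0.
    apply/fsetP => y; rewrite domf_restrict /comp_ivars /comp_svars iM sM /=.
    by rewrite fsetU0 fset0U fsetDv fset0I.
  - by rewrite (a0 _ _ _ (tq j)) => y _ /[dup]; rewrite {1}domf0 in_fset0.
case=> -[qq] [[[] r] [[b [c [r1 [r2 [[/= _ tr _] [_ hr]]]]]] nr]].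
have {hr} rr2 : r = r2.
  case: hr => [] [] // _ // e; case: nr.
  by rewrite e.
apply: (@trans_loop _ _ _ _ _ tr).
  by move=> e; apply: nr; rewrite rr2 e.
by have := tq j; rewrite qq (a0 _ _ _ (tq j)) (a0 _ _ _ tr).
Qed.

End Observer.

(** * The moving agent *)

Section Chooser.
Context (D : Type) (d0 d1 : D).

Definition chooser_lab (q : option bool) : valuation D :=
  [fmap].[0 <- if q is Some true then d1 else d0]%fmap.

(** Staying in [None] is ruled out by [trans_loop], since a proper move exists under the same input.
    [Some false] allows leaving [None] without changing variable 0. *)
Definition chooser_trans
    (t : option bool * valuation D * option bool) : Prop :=
  t.1.2 = [fmap]%fmap /\ (if t.1.1 is None then t.2 <> None else t.2 = t.1.1).

Fact chooser_dom_lab q : domf (chooser_lab q) = [fset 0]%fset.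
Proof. exact: domf_fmap1. Qed.

Fact chooser_dom_trans q a q' : chooser_trans (q, a, q') -> domf a = fset0.
Proof. by case=> /= -> _; rewrite domf0. Qed.

Fact chooser_trans_total q a :
  domf a = fset0 -> exists q', chooser_trans (q, a, q').
Proof.
move=> /valuation0 ->; exists (if q is None then Some false else q).
by case: q.
Qed.

Fact chooser_trans_loop q a q' :
  chooser_trans (q, a, q') -> q <> q' -> ~ chooser_trans (q, a, q).
Proof. by case: q => [b|] [_ /= h] nq [_ /= h']; [case: nq | case: h']. Qed.

Definition chooser : module D :=
  @MkModule D (option bool) [fset 0]%fset fset0 chooser_lab chooser_trans None
    (fdisjointX0 _) chooser_dom_lab chooser_dom_trans chooser_trans_total
    chooser_trans_loop.

End Chooser.

(** * The two-agent system and its formula *)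

Section Counterexample.
Context (D : Type) (d0 d1 : D).

Definition counterexample (i : 'I_2) : agent D :=
  if i == ord0 then full_agent d0 (observer D)
  else full_agent d0 (chooser d0 d1).

(** The atom of the empty valuation is true on every word, so the until means eventually. *)
Definition never_d1 : formula D :=
  Neg (Until (Atom [fmap]%fmap) (Atom [fmap].[0 <- d1]%fmap)).

Lemma sat_never_d1 (w : nat -> valuation D) :
  sat w never_d1 <-> forall j, (w j).[? 0]%fmap <> Some d1.
Proof.
have E j : (w (j + 0)).[& domf [fmap].[0 <- d1]]%fmap = [fmap].[0 <- d1]%fmap
    <-> (w j).[? 0]%fmap = Some d1.
  rewrite addn0; split=> [/fmapP /(_ 0)|h].
    by rewrite fnd_restrict fnd_set domf_fmap1 in_fset1 eqxx.
  apply/fmapP => y; rewrite fnd_restrict fnd_set domf_fmap1 in_fset1.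
  by case: eqP => [->|_]; rewrite ?fnd_fmap0.
split=> /= h; last by case=> j [/E /h].
move=> j /E wj; apply: h; exists j; split=> // l _.
by rewrite restrictf0.
Qed.

Lemma fvars_never_d1 : fvars never_d1 = [fset 0]%fset.
Proof. exact: etrans (fset0U _) (domf_fmap1 _ _). Qed.

Lemma sat_big_and_const (T : Type) (s : seq T) (f : formula D)
    (w : nat -> valuation D) :
  sat w f -> sat w (big_and [seq f | _ <- s]).
Proof.
by move=> wf; elim: s => [|x s IHs] //=; rewrite restrictf0.
Qed.

Lemma fvars_big_and_const (T : Type) (s : seq T) (f : formula D) :
  (fvars (big_and [seq f | _ <- s]) `<=` fvars f)%fset.
Proof.
elim: s => [|x s IHs] /=; first exact: fsub0set.
by rewrite fsubUset fsubset_refl.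
Qed.

Lemma enum_ord2 : enum 'I_2 = [:: ord0; ord_max].
Proof. by apply: (inj_map val_inj); rewrite val_enum_ord. Qed.

(** The guard keeps the set nonempty at [Some true], whose only move is to itself. *)
Definition avoid_d1 (q : chooser d0 d1) : set (transition (chooser d0 d1)) :=
  fun t => [/\ trans _ t, t.1.1 = q & q <> Some true -> t.2 <> Some true].

Lemma full_repertoire_avoid_d1 q : full_repertoire q (avoid_d1 q).
Proof.
split=> [|t []] //.
exists (q, [fmap]%fmap, if q is None then Some false else q).
by case: q => [[]|].
Qed.

(** The match repeats the test inside [counterexample], so that each branch has the type of its
    agent. *)
Definition counterexample_strategy (i : 'I_2) :
    strategy ir (counterexample i) :=
  match i == ord0 as b return strategy ir
    (if b then full_agent d0 (observer D)
     else full_agent d0 (chooser d0 d1)) with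
  | true => fun q t => trans (observer D) t /\ t.1.1 = q
  | false => avoid_d1
  end.

Lemma counterexample_strategyP i :
  @is_strategy D ir (counterexample i) (@counterexample_strategy i).
Proof.
rewrite /counterexample_strategy /counterexample.
case: (i == ord0) => q; last exact: full_repertoire_avoid_d1.
split=> [|t //].
exists (tt, [fmap].[0 <- d0]%fmap, tt); split=> /=; last by case: q.
by rewrite /observer_trans domf_fmap1.
Qed.

(** Variable 0 is the only link, and an enlargement could add only the observer itself, which is
    deleted again. Hence no [k] brings in more than the chooser. *)
Lemma counterexample_nbhd k : nbhd counterexample k ord0 = [set ord_max]%SET.
Proof.
have n0 : nbhd1 counterexample ord0 = [set ord_max]%SET.
  apply/setP => j; rewrite !inE /counterexample eqxx /=.
  rewrite fsetI0 eqxx /=.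
  case: j => [[|[|//]] hj]; rewrite -val_eqE /=.
    by rewrite fsetI0 eqxx.
  rewrite fsetIid; apply/fset0Pn; exists 0; exact: fset11.
rewrite /nbhd n0; elim: k.-1 => //= m ->.
apply/setP => j; rewrite !inE.
by case: j => [[|[|//]] hj]; rewrite -!val_eqE.
Qed.

Lemma counterexample_sys_sat (C : {set 'I_2}) :
  ord_max \in C -> d0 <> d1 ->
  sys_sat ir counterexample C (big_and [seq never_d1 | _ <- enum C]).
Proof.
move=> C1 d01; rewrite /sys_sat enum_ord2; split.
  apply: fsubset_trans (fvars_big_and_const _ _) _; rewrite fvars_never_d1.
  exact: fsubset_trans (fsubsetUl _ fset0) (fsubsetUr fset0 _).
exists @counterexample_strategy; split=> [i _|w].
  exact: counterexample_strategyP.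
case=> q [a [[q0 _] /(_ _ C1) imp <-]]; apply: sat_big_and_const.
(* Uniqueness of equality proofs on ['I_2] removes the cast in [local]. *)
have loc r : @local D _ counterexample [:: ord0; ord_max] ord_max r = r.2.1.
  by rewrite /=; case: eqP => // e1; case: eqP => // e2; rewrite (eq_axiomK e2).
(* Every change of the chooser's local state is prescribed by its strategy, which never enters
   [Some true] from another state. *)
have inv j : (q j).2.1 <> Some true.
  elim: j => [|j IHj]; first by rewrite q0.
  have [<- //|nq] := pselect ((q j).2.1 = (q j.+1).2.1).
  by have := imp j; rewrite /prescribed /comp !loc => /(_ nq) [_ _ /(_ IHj)].
apply/sat_never_d1 => j; rewrite /derived.
rewrite -[lab _ _]/([fmap]%fmap + (chooser_lab d0 d1 (q j).2.1 + [fmap]%fmap))%fset.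
rewrite cat0f catf0 /chooser_lab fnd_set eqxx.
by move: (inv j); case: (q j).2.1 => [[]|] // _ [].
Qed.

Lemma counterexample_not_derivable (k : nat) (A : assumption D) :
  assume_sat ir (counterexample ord0) A never_d1 ->
  ~ guarantees counterexample (enum (nbhd counterexample k ord0)) A.
Proof.
rewrite counterexample_nbhd enum_set1.
case=> _ sA [s [_ sat_s]] [sA' iA /(_ _ _ _)/= gA].
(* The guarantee confines the state variables of [A] to those of the chooser, and the formula needs
   variable 0, which the observer does not own. *)
have {sA sA'} sA : svars A = [fset 0]%fset.
  apply/eqP; rewrite eqEfsubset; apply/andP; split.
    by move: sA'; rewrite /= /comp_svars /= fsetU0.
  by move: sA; rewrite fvars_never_d1 /= /comp_svars /= fset0U.
have {}iA : ivars A = fset0.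
  by apply/eqP; rewrite -fsubset0; move: iA; rewrite big_seq1.
pose q j : chooser d0 d1 * unit := (if j is 0 then None else Some true, tt).
have tq : @is_trace D (comps counterexample [:: ord_max]) q
            (fun=> [fmap]%fmap).
  split=> // j; split.
    exists [fmap]%fmap, [fmap]%fmap, (Some true), tt; split.
      split=> //; first by case: j.
      by rewrite cat0f restrictf_id // fdisjoint0X.
    by split; [split=> // | case: j => [|j]; exact: Or33].
  (* The self-loops at [Some true] survive the removal because that state is absorbing. *)
  case: j => [|j] [] // _ [r [[b [c [r1 [r2 [[[_ /= ->] _ _] [_ hr]]]]]] nr]].
  by apply: nr; case: hr => ->; case: r2.
have [c [v [c0 cS vw [r [tr rv Fr]]]]] := gA q _ tq.
set a := (fun i => _) in tr.
(* However the curtailment groups positions, block 1 starts at [c 1], which is at least 1, so the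
   chooser has already moved. *)
have v1 : v 1 = chooser_lab d0 d1 (Some true).
  rewrite (vw 1 (c 1)) ?leqnn ?cS // sA.
  have := cS 0; rewrite c0.
  rewrite /derived /=; case: (c 1) => // m _.
  rewrite -[comp_lab _]/(chooser_lab d0 d1 (Some true) + [fmap]%fmap)%fset.
  rewrite catf0; apply/fmapP => y; rewrite fnd_restrict fnd_set in_fset1.
  by case: eqP => // _; rewrite fnd_fmap0.
(* The run [r] beside the idle observer implements [s] vacuously, as the observer never changes
   state. *)
have /sat_never_d1 /(_ 1) : sat (derived (M := compose (observer D) A)
    (fun j => (tt, r j))) never_d1.
  apply: sat_s.
    by exists (fun j => (tt, r j)), a; split=> //; exact: observer_trace.
  exists a, (fun j => (tt, r j)); split=> //; first exact: observer_trace.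
  by move=> j; have [l jl] := Fr j; exists l; rewrite inE.
apply; rewrite -[derived _ 1]/([fmap]%fmap + derived r 1)%fset cat0f rv v1.
by rewrite fnd_set eqxx.
Qed.

End Counterexample.

Theorem theorem2 (D : Type) (d0 d1 : D) (d01 : d0 <> d1) :
  exists (x : strategy_type) (n : nat) (G : 'I_n -> agent D) (C : {set 'I_n})
         (psi : 'I_n -> formula D),
    [/\ forall i j, i <> j -> asynchronous (G i) (G j),
        forall i, i \in C -> local_formula (G i) (psi i),
        sys_sat x G C (big_and [seq psi i | i <- enum C]) &
        ~ exists (k : nat) (A : 'I_n -> assumption D),
            [/\ 1 <= k,
                forall i, i \in C -> assume_sat x (G i) (A i) (psi i) &
                forall i, i \in C -> guarantees G (enum (nbhd G k i)) (A i)]].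
Proof.
(* The chooser is in the coalition because its strategy makes the conclusion true; the contradictory
   premises are those of the observer, [ord0]. *)
exists ir, 2, (counterexample d0 d1), [set: 'I_2]%SET, (fun=> never_d1 d1).
split.
- rewrite /counterexample.
  case=> [[|[|//]] hi] [[|[|//]] hj] nij; rewrite /asynchronous /=.
  + by case: nij; apply: val_inj.
  + exact: fdisjoint0X.
  + exact: fdisjointX0.
  + by case: nij; apply: val_inj.
- move=> [[|[|//]] hi] _; rewrite /local_formula fvars_never_d1.
    exact: fsubsetUr.
  exact: fsubsetUl.
- by apply: counterexample_sys_sat; rewrite ?inE.
case=> k [A [_ /(_ ord0 (finset.in_setT _)) sA /(_ ord0 (finset.in_setT _))]].
exact: counterexample_not_derivable.
Qed.
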